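(* Let $d\ge1$, $\kappa>0$, let $H$ be a $d\times d$ Hermitian matrix and $V\in\mathbb U(d)$. Let $U_1(t),\dots,U_N(t)\in\mathbb U(d)$, $t\ge0$, be a solution of the Lohe matrix model with frustration $$\mathrm i\,\dot U_jU_j^*=H+\frac{\mathrm i\kappa}{2N}\sum_{k=1}^N\big(VU_kU_j^*-U_jU_k^*V^*\big),\qquad U_j(0)=U_j^0\in\mathbb U(d),\qquad j=1,\dots,N.$$ Suppose that $$\|V-I_d\|_{\mathrm F}<\frac23\qquad\text{and}\qquad\max_{1\le i,j\le N}\|U_i^0-U_j^0\|_{\mathrm F}<\sqrt{2-3\|V-I_d\|_{\mathrm F}}.$$ Then $$\lim_{t\to\infty}\max_{1\le i,j\le N}\|U_i(t)-U_j(t)\|_{\mathrm F}=0.$$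
   Context: $\mathbb U(d)$ is the group of $d\times d$ unitary matrices, $^*$ denotes the Hermitian conjugate, and $\|\cdot\|_{\mathrm F}$ the Frobenius norm. *)

(* Defs.v *)
From HB Require Import structures.
From mathcomp Require Import all_boot all_order all_algebra.
From mathcomp Require Import all_classical all_reals all_analysis.
From mathcomp Require Import complex.
Import Order.TTheory GRing.Theory Num.Theory.
Import numFieldNormedType.Exports.

Set Implicit Arguments.
Unset Strict Implicit.
Unset Printing Implicit Defensive.

Local Open Scope classical_set_scope.
Local Open Scope complex_scope.
Local Open Scope sesquilinear_scope.
Local Open Scope ring_scope.

(* The modulus [ComplexField.Normc.normc] takes its values in [R], whereas
   the generic norm [`|z|] of [z : R[i]] lives in [R[i]]. *)
Definition frobenius (R : realType) (m n : nat) (A : 'M[R[i]]_(m, n)) : R :=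
  Num.sqrt (\sum_i \sum_j ComplexField.Normc.normc (A i j) ^+ 2).

(* [X] is only relevant on [0, +oo[: the derivative is two-sided at [t > 0]
   and is the right derivative at [t = 0]. *)
Definition has_derivative (R : realType) (m n : nat)
    (X : R -> 'M[R[i]]_(m, n)) (t : R) (D : 'M[R[i]]_(m, n)) : Prop :=
  frobenius ((h^-1)%:C *: (X (t + h) - X t) - D)
    @[h --> within [set h : R | 0 <= t + h] 0^'] --> (0 : R).

Definition lohe_solution (R : realType) (d N : nat) (kappa : R)
    (H V : 'M[R[i]]_d) (U0 : 'I_N -> 'M[R[i]]_d)
    (U : 'I_N -> R -> 'M[R[i]]_d) : Prop :=
  [/\ forall j t, 0 <= t -> U j t \is unitarymx,
      forall j, U j 0 = U0 j &
      forall j t, 0 <= t ->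
        exists2 D : 'M[R[i]]_d, has_derivative (U j) t D &
          'i%C *: (D *m (U j t)^t*) =
            H + ('i%C * (kappa / (2 * N%:R))%:C) *:
              \sum_(k < N) (V *m U k t *m (U j t)^t* -
                            U j t *m (U k t)^t* *m V^t*)].

(* All the terms are nonnegative, so that the default value 0 is harmless. *)
Definition diameter (R : realType) (d N : nat) (X : 'I_N -> 'M[R[i]]_d) : R :=
  \big[Num.max/0]_(i < N) \big[Num.max/0]_(j < N) frobenius (X i - X j).

(* Main.v *)
(* With D = U_i - U_j, W_k = U_k^* V^* and <A, B> = Re tr (A B^* ), the Hermitian
   part of the drift drops out and
     d/dt |D|^2 = - (kappa / N) sum_k (<D W_k U_i, D> + <D W_k U_j, D>).
   Each Z = W_k U_i is unitary, so <D Z, D> = |D|^2 - |D (1 - Z)|^2 / 2, where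
   |1 - Z| = |V U_k - U_i| <= |V - 1| + |U_k - U_i|.  Writing v = |V - 1|, the
   squared distances therefore decay at rate kappa (2 - (m + v)^2) as long as the
   diameter is at most m, and this rate is positive when m < sqrt (2 - 3 v)
   because (sqrt (2 - 3 v) + v)^2 <= 2.  Hence the diameter never reaches such
   an m above its initial value, and tends to 0. *)

Require Import Defs.
From HB Require Import structures.
From mathcomp Require Import all_boot all_order all_algebra.
From mathcomp Require Import all_classical all_reals all_analysis.
From mathcomp Require Import complex.
From mathcomp Require Import ring lra.
Import Order.TTheory GRing.Theory Num.Theory.
Import numFieldNormedType.Exports.
Local Open Scope classical_set_scope.
Local Open Scope complex_scope.
Local Open Scope sesquilinear_scope.
Local Open Scope ring_scope.

Set Implicit Arguments.
Unset Strict Implicit.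

(** * The real inner product Re tr (A B^* ) and the Frobenius norm *)

Definition ip (R : realType) m n (A B : 'M[R[i]]_(m, n)) : R :=
  complex.Re (\tr (A *m B^t* )).

Lemma ReD (R : realType) (x y : R[i]) :
  complex.Re (x + y) = complex.Re x + complex.Re y.
Proof. by case: x y => [? ?] [? ?]. Qed.

Lemma ReN (R : realType) (x : R[i]) : complex.Re (- x) = - complex.Re x.
Proof. by case: x. Qed.

Lemma ReZ (R : realType) (a : R) (x : R[i]) :
  complex.Re (a%:C * x) = a * complex.Re x.
Proof. by case: x => x y /=; rewrite mul0r subr0. Qed.

Lemma ReJ (R : realType) (x : R[i]) : complex.Re (Num.conj x) = complex.Re x.
Proof. by case: x. Qed.

Lemma trmxC_mul (R : realType) m n p (A : 'M[R[i]]_(m, n)) (B : 'M[R[i]]_(n, p)) :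
  (A *m B)^t* = B^t* *m A^t*.
Proof. by rewrite trmx_mul map_mxM. Qed.

Section InnerProduct.
Variable R : realType.
Implicit Types m n p : nat.

Lemma ipDl m n (A B C : 'M[R[i]]_(m, n)) : ip (A + B) C = ip A C + ip B C.
Proof. by rewrite /ip mulmxDl mxtraceD ReD. Qed.

Lemma ipNl m n (A C : 'M[R[i]]_(m, n)) : ip (- A) C = - ip A C.
Proof. by rewrite /ip mulNmx -scaleN1r mxtraceZ mulN1r ReN. Qed.

Lemma ipBl m n (A B C : 'M[R[i]]_(m, n)) : ip (A - B) C = ip A C - ip B C.
Proof. by rewrite ipDl ipNl. Qed.

Lemma ipZl m n (a : R) (A C : 'M[R[i]]_(m, n)) :
  ip (a%:C *: A) C = a * ip A C.
Proof. by rewrite /ip -scalemxAl mxtraceZ ReZ. Qed.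

Lemma ip_suml m n (I : finType) (F : I -> 'M[R[i]]_(m, n)) C :
  ip (\sum_i F i) C = \sum_i ip (F i) C.
Proof.
apply: (big_ind2 (fun X x => ip X C = x)) => //.
  by rewrite /ip mul0mx mxtrace0.
by move=> ? ? ? ? <- <-; rewrite ipDl.
Qed.

Lemma ipC m n (A B : 'M[R[i]]_(m, n)) : ip A B = ip B A.
Proof.
rewrite /ip -[RHS]ReJ -[in RHS]mxtrace_tr.
rewrite -trace_map_mx; congr (complex.Re (\tr _)).
by rewrite trmxC_mul trmxCK.
Qed.

Lemma ipDr m n (A B C : 'M[R[i]]_(m, n)) : ip C (A + B) = ip C A + ip C B.
Proof. by rewrite ipC ipDl !(ipC C). Qed.

Lemma ipBr m n (A B C : 'M[R[i]]_(m, n)) : ip C (A - B) = ip C A - ip C B.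
Proof. by rewrite ipC ipBl !(ipC C). Qed.

Lemma ipZr m n (a : R) (A C : 'M[R[i]]_(m, n)) :
  ip C (a%:C *: A) = a * ip C A.
Proof. by rewrite ipC ipZl ipC. Qed.

Lemma ip_mull m n p (P : 'M[R[i]]_(m, n)) (A : 'M[R[i]]_(n, p)) B :
  ip (P *m A) B = ip A (P^t* *m B).
Proof. by rewrite /ip trmxC_mul trmxCK -mulmxA mxtrace_mulC mulmxA. Qed.

Lemma ip_mulr m n p (A : 'M[R[i]]_(m, n)) (P : 'M[R[i]]_(n, p)) B :
  ip (A *m P) B = ip A (B *m P^t* ).
Proof. by rewrite /ip trmxC_mul trmxCK mulmxA. Qed.

(** Moving [K] across the inner product and using symmetry turns the value into its own opposite. *)
Lemma ip_mulmxl_skew n (K A : 'M[R[i]]_n) : K^t* = - K -> ip (K *m A) A = 0.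
Proof.
move=> hK; have : ip (K *m A) A = - ip (K *m A) A.
  by rewrite {1}ip_mull hK mulNmx ipC ipNl.
by lra.
Qed.

Lemma normc_ge0 (z : R[i]) : 0 <= ComplexField.Normc.normc z.
Proof. by case: z => a b; rewrite sqrtr_ge0. Qed.

Lemma frobenius_ge0 m n (A : 'M[R[i]]_(m, n)) : 0 <= frobenius A.
Proof. exact: sqrtr_ge0. Qed.

Lemma frobeniusE m n (A : 'M[R[i]]_(m, n)) : frobenius A ^+ 2 = ip A A.
Proof.
rewrite sqr_sqrtr; last by do 2!apply: sumr_ge0 => ? _; exact: sqr_ge0.
rewrite /ip /mxtrace.
rewrite (big_morph (@complex.Re R) (@ReD R) (erefl : complex.Re 0 = 0)).
apply: eq_bigr => i _; rewrite mxE.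
rewrite (big_morph (@complex.Re R) (@ReD R) (erefl : complex.Re 0 = 0)).
apply: eq_bigr => j _; rewrite !mxE.
case: (A i j) => a b /=.
by rewrite sqr_sqrtr ?addr_ge0 ?sqr_ge0 // mulrN opprK.
Qed.

Lemma ip_ge0 m n (A : 'M[R[i]]_(m, n)) : 0 <= ip A A.
Proof. by rewrite -frobeniusE sqr_ge0. Qed.

Lemma frobenius_ip m n (A : 'M[R[i]]_(m, n)) : frobenius A = Num.sqrt (ip A A).
Proof. by rewrite -frobeniusE sqrtr_sqr ger0_norm // frobenius_ge0. Qed.

Lemma frobeniusN m n (A : 'M[R[i]]_(m, n)) : frobenius (- A) = frobenius A.
Proof. by rewrite !frobenius_ip ipNl ipC ipNl opprK. Qed.

(** * Cauchy-Schwarz and the norm inequalities *)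

Lemma discriminant_le (a b c : R) : 0 <= b ->
  (forall x, 0 <= a - 2 * x * c + x ^+ 2 * b) -> c ^+ 2 <= a * b.
Proof.
move=> b0 key; have [bE|bN] := eqVneq b 0.
  have [->|cN] := eqVneq c 0; first by rewrite expr0n bE mulr0.
  (* With [b = 0] and [c] nonzero, the affine function takes the value -1 at this point. *)
  have := key ((a + 1) / (2 * c)); rewrite bE mulr0 addr0.
  have -> : 2 * ((a + 1) / (2 * c)) * c = a + 1 by field.
  by lra.
have bp : 0 < b by rewrite lt_def bN.
(* [c / b] is the minimizer of the quadratic. *)
have := key (c / b); rewrite -(pmulr_lge0 _ bp).
have -> : (a - 2 * (c / b) * c + (c / b) ^+ 2 * b) * b = a * b - c ^+ 2.
  by field.
by rewrite subr_ge0.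
Qed.

Lemma ip_le_frobenius m n (A B : 'M[R[i]]_(m, n)) :
  `|ip A B| <= frobenius A * frobenius B.
Proof.
rewrite !frobenius_ip -sqrtrM ?ip_ge0 // -sqrtr_sqr ler_wsqrtr //.
apply: discriminant_le => [|x]; first exact: ip_ge0.
have := ip_ge0 (A - x%:C *: B).
rewrite ipBl !ipBr !ipZl !ipZr (ipC B A).
by move: (ip A A) (ip A B) (ip B B) => a c b; congr (_ <= _); ring.
Qed.

Lemma frobeniusD m n (A B : 'M[R[i]]_(m, n)) :
  frobenius (A + B) <= frobenius A + frobenius B.
Proof.
rewrite -(@ler_pXn2r _ 2) ?nnegrE ?addr_ge0 ?frobenius_ge0 //.
rewrite sqrrD !frobeniusE ipDl !ipDr (ipC B A).
move: (le_trans (ler_norm _) (ip_le_frobenius A B)).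
by move: (ip A A) (ip A B) (ip B B) (frobenius A * _) => a c b f; lra.
Qed.

(** Lagrange's identity: the double sum of squares below is twice the gap between the two sides. *)
Lemma sqr_sum_mul_le (I : finType) (x y : I -> R) :
  (\sum_i x i * y i) ^+ 2 <= (\sum_i x i ^+ 2) * (\sum_i y i ^+ 2).
Proof.
have : 0 <= \sum_i \sum_j (x i * y j - x j * y i) ^+ 2.
  by do 2!apply: sumr_ge0 => ? _; exact: sqr_ge0.
have -> : \sum_i \sum_j (x i * y j - x j * y i) ^+ 2 =
    \sum_i \sum_j (x i ^+ 2 * y j ^+ 2) + \sum_i \sum_j (y i ^+ 2 * x j ^+ 2)
    - 2 * \sum_i \sum_j ((x i * y i) * (x j * y j)).
  rewrite mulr_sumr -big_split /= -sumrB; apply: eq_bigr => i _.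
  rewrite mulr_sumr -big_split /= -sumrB; apply: eq_bigr => j _; ring.
rewrite -!big_distrlr /=; lra.
Qed.

Lemma normc_sum (I : finType) (F : I -> R[i]) :
  ComplexField.Normc.normc (\sum_i F i) <=
  \sum_i ComplexField.Normc.normc (F i).
Proof.
apply: (big_ind2 (fun x y => ComplexField.Normc.normc x <= y)) => //.
  by rewrite ComplexField.Normc.normc0.
move=> x1 x2 y1 y2 h1 h2.
exact: le_trans (le_normcD _ _) (lerD h1 h2).
Qed.

Lemma frobeniusM m n p (A : 'M[R[i]]_(m, n)) (B : 'M[R[i]]_(n, p)) :
  frobenius (A *m B) <= frobenius A * frobenius B.
Proof.
rewrite /frobenius -sqrtrM; last first.
  by do 2!apply: sumr_ge0 => ? _; exact: sqr_ge0.
(* After this reordering the right side is a sum over [(i, k)] of row [i] of [A] times column [k] of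
   [B], which allows Cauchy-Schwarz entry by entry. *)
apply: ler_wsqrtr; rewrite [X in _ * X]exchange_big big_distrlr /=.
apply: ler_sum => i _; apply: ler_sum => k _; rewrite mxE.
apply: le_trans (sqr_sum_mul_le _ _).
rewrite ler_pXn2r ?nnegrE ?normc_ge0 //; last first.
  by apply: sumr_ge0 => j _; rewrite mulr_ge0 ?normc_ge0.
apply: le_trans (normc_sum _) _.
by apply: ler_sum => j _; rewrite ComplexField.Normc.normcM.
Qed.

(** * Unitary factors and the alignment estimate *)

Lemma frobenius_unitarymxl n p (Q : 'M[R[i]]_n) (A : 'M[R[i]]_(n, p)) :
  Q *m Q^t* = 1%:M -> frobenius (Q *m A) = frobenius A.
Proof.
by move=> /mulmx1C hQ; rewrite !frobenius_ip ip_mull mulmxA hQ mul1mx.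
Qed.

Lemma frobenius_unitarymxr n p (Q : 'M[R[i]]_n) (A : 'M[R[i]]_(p, n)) :
  Q *m Q^t* = 1%:M -> frobenius (A *m Q) = frobenius A.
Proof. by move=> hQ; rewrite !frobenius_ip ip_mulr -mulmxA hQ mulmx1. Qed.

(** Polarization: expand the square of [D - D *m Z], where [D *m Z] has the norm of [D]. *)
Lemma ip_mul_unitarymxr m n (D : 'M[R[i]]_(m, n)) (Z : 'M[R[i]]_n) :
  Z *m Z^t* = 1%:M ->
  ip (D *m Z) D = frobenius D ^+ 2 - frobenius (D *m (1%:M - Z)) ^+ 2 / 2.
Proof.
move=> hZ; rewrite !frobeniusE mulmxBr mulmx1.
have h : ip (D *m Z) (D *m Z) = ip D D.
  by rewrite -!frobeniusE frobenius_unitarymxr.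
by rewrite ipBl !ipBr h (ipC D (D *m Z)); field.
Qed.

Lemma ip_alignment d (V X Y D : 'M[R[i]]_d) (m : R) :
  V *m V^t* = 1%:M -> X *m X^t* = 1%:M -> Y *m Y^t* = 1%:M ->
  frobenius (X - Y) <= m ->
  frobenius D ^+ 2 * (1 - (m + frobenius (V - 1%:M)) ^+ 2 / 2) <=
  ip (D *m (Y^t* *m V^t* ) *m X) D.
Proof.
move=> hV hX hY hm.
have hVY : (V *m Y) *m (V *m Y)^t* = 1%:M.
  by rewrite trmxC_mul mulmxA -(mulmxA V) hY mulmx1.
rewrite -trmxC_mul -mulmxA; set Z := _ *m X.
have hZ : Z *m Z^t* = 1%:M.
  by rewrite trmxC_mul trmxCK mulmxA -(mulmxA _ X) hX mulmx1 (mulmx1C hVY).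
rewrite ip_mul_unitarymxr //; set v := frobenius (V - _).
have h1 : frobenius (1%:M - Z) <= m + v.
  have -> : frobenius (1%:M - Z) = frobenius (V *m Y - X).
    rewrite -[LHS](frobenius_unitarymxl _ hVY) mulmxBr mulmx1 mulmxA hVY.
    by rewrite mul1mx.
  have -> : V *m Y - X = (V - 1%:M) *m Y - (X - Y).
    by rewrite mulmxBl mul1mx opprB addrA subrK.
  apply: le_trans (frobeniusD _ _) _.
  by rewrite frobenius_unitarymxr // frobeniusN addrC lerD2r.
(* No sign is assumed for [m]; the norm bound supplies the one needed for squaring. *)
have mv0 : 0 <= m + v by exact: le_trans (frobenius_ge0 _) h1.
have h2 : frobenius (D *m (1%:M - Z)) ^+ 2 <= frobenius D ^+ 2 * (m + v) ^+ 2.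
  rewrite -exprMn ler_pXn2r ?nnegrE ?mulr_ge0 ?frobenius_ge0 //.
  apply: le_trans (frobeniusM _ _) _.
  by rewrite ler_wpM2l ?frobenius_ge0.
move: h2; move: (frobenius D ^+ 2) (frobenius _ ^+ 2) ((m + v) ^+ 2) => a b c.
by lra.
Qed.

(** By cyclicity of the trace, each side is the real part of the trace of [W] times a matrix.
    Unitarity reduces both matrices to [X + Y - X Y^t* X - Y X^t* Y]. *)
Lemma ip_quadratic_difference d (X Y W : 'M[R[i]]_d) :
  X *m X^t* = 1%:M -> Y *m Y^t* = 1%:M ->
  ip (X *m W *m X - Y *m W *m Y) (X - Y) =
  ip ((X - Y) *m W *m X) (X - Y) + ip ((X - Y) *m W *m Y) (X - Y).
Proof.
move=> hX hY; have hX' := mulmx1C hX; have hY' := mulmx1C hY.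
have tr_cycle (A B C : 'M[R[i]]_d) :
    \tr (A *m W *m B *m C) = \tr (W *m (B *m C *m A)).
  by rewrite -!mulmxA mxtrace_mulC !mulmxA.
rewrite ipBl -ReN -!ReD !tr_cycle -raddfN -!raddfD /= -mulmxN -!mulmxDr.
congr (complex.Re (\tr (_ *m _))).
have -> : (X - Y)^t* = X^t* - Y^t* by rewrite raddfB map_mxB.
rewrite !(mulmxBl, mulmxBr) hX hY -!mulmxA hX' hY' !mulmx1 !mul1mx.
by apply/matrixP => i j; rewrite !mxE; ring.
Qed.

End InnerProduct.

(** * A barrier argument for finite families of decaying functions *)

(* Like [has_derivative]: two-sided at t > 0, one-sided at t = 0. *)
Definition deriv_ge0 (R : realType) (f : R -> R) (t l : R) : Prop :=
  h^-1 * (f (t + h) - f t) @[h --> within [set h | 0 <= t + h] 0^'] --> l.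

Section DecayingFamily.
Variable R : realType.

(** For [t > 0] the constraint [0 <= t + h] holds for all small [h], so it does not restrict the
    limit. *)
Lemma deriv_ge0_is_derive (f : R -> R) (t l : R) :
  0 < t -> deriv_ge0 f t l -> is_derive t 1 f l.
Proof.
move=> t0 hf.
have hf1 : h^-1 * (f (t + h) - f t) @[h --> 0^'] --> l.
  move=> A /hf hA.
  have hw : \forall h \near (0 : R)^', 0 <= t + h.
    apply: nbhs_dnbhs; near=> h.
    rewrite -lerBlDl sub0r ltW //; near: h; apply: lt_nbhsr; lra.
  have {}hA : \forall h \near (0 : R)^', 0 <= t + h ->
    A (h^-1 * (f (t + h) - f t)) by exact: hA.
  by apply: filterS2 hw hA => h h1; exact.
have hf' : h^-1 *: ((f \o shift t) (h *: 1) - f t) @[h --> 0^'] --> l.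
  rewrite (_ : (fun h => _) = fun h : R => h^-1 * (f (t + h) - f t)) //.
  by apply/funext => h; rewrite /= [h *: 1]mulr1 (addrC h).
by split; [exact: cvgP hf'|exact: cvg_lim hf'].
Unshelve. all: by end_near. Qed.

Lemma deriv_ge0_cvg_right (f : R -> R) (t l : R) :
  0 <= t -> deriv_ge0 f t l -> f s @[s --> t^'+] --> f t.
Proof.
move=> t0 hf.
have h0 : f (t + h) @[h --> 0^'+] --> f t.
  have hq : h^-1 * (f (t + h) - f t) @[h --> 0^'+] --> l.
    move=> A /hf hA.
    have {}hA : \forall h \near (0 : R), h != 0 -> 0 <= t + h ->
      A (h^-1 * (f (t + h) - f t)) by exact: hA.
    suff : \forall h \near (0 : R), 0 < h -> A (h^-1 * (f (t + h) - f t)).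
      exact.
    apply: filterS hA => h hA h0; apply: hA; first by rewrite gt_eqF.
    by rewrite addr_ge0 // ltW.
  have hid : h @[h --> (0 : R)^'+] --> (0 : R).
    by apply: cvg_at_right_filter; exact: cvg_id.
  have hlim : h * (h^-1 * (f (t + h) - f t)) + f t @[h --> 0^'+]
      --> 0 * l + f t.
    by apply: cvgD; [exact: cvgM|exact: cvg_cst].
  rewrite mul0r add0r in hlim.
  apply: (cvg_trans _ hlim); apply: near_eq_cvg; near=> h.
  have hp : h != 0 by near: h; exact: nbhs_right_neq.
  by rewrite /= mulrA mulfV // mul1r subrK.
by move=> A /h0 hA; apply/nbhs_right0P; exact: hA.
Unshelve. all: by end_near. Qed.

(** Mean value theorem. The sign is required only strictly before [T], because in the barrier
    argument nothing is known yet at [T] itself. *)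
Lemma deriv_ge0_nonincreasing (f f' : R -> R) (T : R) : 0 <= T ->
  (forall t : R, 0 <= t -> deriv_ge0 f t (f' t)) ->
  (forall t : R, 0 < t < T -> f' t <= 0) ->
  f T <= f 0.
Proof.
rewrite le_eqVlt => /predU1P[<- //|T0] hf hf'.
have hd (t : R) : 0 < t -> is_derive t 1 f (f' t).
  by move=> t0; apply: deriv_ge0_is_derive => //; apply: hf; exact: ltW.
have hc (t : R) : 0 < t -> {for t, continuous f}.
  move=> /hd [h _]; apply: differentiable_continuous.
  exact/derivable1_diffP.
have cont : {within `[0, T], continuous f}.
  apply/continuous_within_itvP => //; split.
  - by move=> t; rewrite in_itv => /andP[t0 _]; exact: hc.
  - exact: deriv_ge0_cvg_right (hf _ (lexx 0)).
  - exact/cvg_at_left_filter/hc.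
have [t|c] := MVT T0 _ cont (df := f').
  by rewrite in_itv => /andP[t0 _]; exact: hd.
rewrite in_itv subr0 /= => /hf' hc' hfe.
rewrite -subr_le0 hfe; apply: mulr_le0_ge0 => //; exact: ltW.
Qed.

(** The factor [1 + c * s] plays the part of the exponential in Gronwall's argument: it gives a
    slower decay, but one that still tends to 0. *)
Lemma deriv_ge0M_affine (f : R -> R) (c t l : R) : 0 <= t ->
  deriv_ge0 f t l ->
  deriv_ge0 (fun s => f s * (1 + c * s)) t (l * (1 + c * t) + c * f t).
Proof.
rewrite /deriv_ge0; set F := within _ _ => t0 hf.
have FF : Filter F by exact: within_filter.
have hid : h @[h --> F] --> (0 : R).
  by apply: cvg_within_filter; exact: nbhs_dnbhs.
have haff : 1 + c * (t + h) @[h --> F] --> 1 + c * t.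
  rewrite -[X in _ --> 1 + c * X](addr0 t).
  by apply: cvgD; [exact: cvg_cst|apply: cvgM; [exact: cvg_cst|
    apply: cvgD; [exact: cvg_cst|]]].
have hlim : h^-1 * (f (t + h) - f t) * (1 + c * (t + h)) + c * f t
    @[h --> F] --> l * (1 + c * t) + c * f t.
  by apply: cvgD; [exact: cvgM|exact: cvg_cst].
apply: (cvg_trans _ hlim); apply: near_eq_cvg.
have : \forall h \near F, h != 0.
  by apply: cvg_within; apply: withinT.
by apply: filterS => h h0 /=; field.
Qed.

Variables (I : finType) (f : I -> R -> R) (c M : R).
Hypotheses (c0 : 0 < c) (f0 : forall p, f p 0 < M).
Hypothesis f_ge0 : forall p (t : R), 0 <= t -> 0 <= f p t.
Hypothesis f_deriv : forall p (t : R), 0 <= t -> exists2 l, deriv_ge0 (f p) t l &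
  (forall q, f q t <= M) -> l <= - (c * f p t).

(** Choice packs the pointwise derivatives into one function, as the mean value theorem demands. *)
Lemma deriv_choice p : exists f' : R -> R, forall t : R, 0 <= t ->
  deriv_ge0 (f p) t (f' t) /\
  ((forall q, f q t <= M) -> f' t <= - (c * f p t)).
Proof.
have h (t : R) : exists l, 0 <= t -> deriv_ge0 (f p) t l /\
    ((forall q, f q t <= M) -> l <= - (c * f p t)).
  have [/f_deriv-/(_ p)[l h1 h2]|t0] := boolP (0 <= t); first by exists l.
  by exists 0.
by exists (fun t => projT1 (cid (h t))) => t; exact: projT2 (cid (h t)).
Qed.

(** The decay estimate is available only while the whole family is at most [M]. Before the first
    time [inf A] at which some member reaches [M], every member is nonincreasing, hence still below
    [M] at [inf A]; right continuity carries this a little further, which is absurd. *)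
Lemma family_lt_barrier p (t : R) : 0 <= t -> f p t < M.
Proof.
move=> t0; rewrite ltNge; apply/negP => hMt.
pose A := [set s | 0 <= s /\ exists q, M <= f q s].
have A0 : A !=set0 by exists t; split => //; exists p.
have lbA : lbound A 0 by move=> s [].
have T0 : 0 <= inf A by exact: lb_le_inf.
have hT q : f q (inf A) < M.
  have [f' hf'] := deriv_choice q.
  apply: le_lt_trans (f0 q).
  apply: (@deriv_ge0_nonincreasing _ f') => // s.
    by move=> /hf'[].
  move=> /andP[s0 sT]; have [_ h] := hf' s (ltW s0).
  apply: le_trans (h _) _.
    move=> r; rewrite leNgt; apply/negP => hr.
    have : inf A <= s.
      by apply: ge_inf; [exists 0|split; [exact: ltW|exists r; exact: ltW]].
    by rewrite leNgt sT.
  by rewrite oppr_le0; apply: mulr_ge0; [exact: ltW|exact/f_ge0/ltW].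
(* By right continuity, no f q reaches M shortly after inf A. *)
have hnear : \forall s \near (inf A)^'+, forall q, f q s < M.
  apply: filter_forall => q.
  have [l hl _] := f_deriv q T0.
  exact: cvgr_lt (deriv_ge0_cvg_right T0 hl) _ (hT q).
have [e /= e0 he] := hnear.
(* No point of [A] lies below [inf A + e / 2]; [inf A] itself, outside the punctured neighbourhood,
   is excluded by [hT]. *)
have : inf A + e / 2 <= inf A.
  apply: lb_le_inf => // s [s0 [q hq]].
  have sT : inf A <= s by apply: ge_inf; [exists 0|split => //; exists q].
  rewrite leNgt; apply/negP => hs.
  have [sE|sN] := eqVneq s (inf A); first by move: hq; rewrite sE leNgt hT.
  have : f q s < M.
    apply: he; last by rewrite lt_def sN.
    rewrite /ball /= distrC ger0_norm ?subr_ge0 //; lra.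
  by rewrite ltNge hq.
by lra.
Qed.

Lemma family_decay p (t : R) : 0 <= t -> f p t <= M / (1 + c * t).
Proof.
move=> t0; have ct : 0 < 1 + c * t by rewrite ltr_pwDl ?mulr_ge0 // ltW.
rewrite ler_pdivlMr //; apply: le_trans (ltW (f0 p)).
have [f' hf'] := deriv_choice p.
(* f p s * (1 + c s) is nonincreasing: its derivative is at most - c^2 s f p s. *)
have := @deriv_ge0_nonincreasing (fun s => f p s * (1 + c * s))
  (fun s => f' s * (1 + c * s) + c * f p s) _ t0.
rewrite mulr0 addr0 mulr1; apply=> s.
  by move=> s0; apply: deriv_ge0M_affine => //; have [] := hf' s s0.
move=> /andP[/ltW s0 _]; have [_ h] := hf' s s0.
have cs : 0 <= c * s by rewrite mulr_ge0 // ltW.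
have cf : 0 <= c * f p s by rewrite mulr_ge0 ?f_ge0 // ltW.
have : f' s <= - (c * f p s).
  by apply: h => q; exact/ltW/family_lt_barrier.
move: cs cf (f' s) => {h}; move: (c * s) (c * f p s) => a b a0 b0 x xb.
by nra.
Qed.

End DecayingFamily.

(** * The Lohe matrix flow *)

Section MatrixDerivative.
Variable R : realType.

Lemma has_derivativeB m n (X Y : R -> 'M[R[i]]_(m, n)) (t : R) D E :
  has_derivative X t D -> has_derivative Y t E ->
  has_derivative (fun s => X s - Y s) t (D - E).
Proof.
rewrite /has_derivative; set F := within _ _ => hX hY.
have FF : Filter F by exact: within_filter.
have h0 : frobenius ((h^-1)%:C *: (X (t + h) - X t) - D) +
    frobenius ((h^-1)%:C *: (Y (t + h) - Y t) - E) @[h --> F] --> (0 : R).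
  by rewrite -[X in _ --> X]addr0; apply: cvgD.
apply: (squeeze_cvgr _ (cvg_cst 0) h0); apply: nearW => h /=.
rewrite frobenius_ge0 /=.
rewrite (_ : _ - (D - E) = ((h^-1)%:C *: (X (t + h) - X t) - D)
  - ((h^-1)%:C *: (Y (t + h) - Y t) - E)); last first.
  by rewrite !scalerBr; apply/matrixP => i j; rewrite !mxE; ring.
apply: le_trans (frobeniusD _ _) _.
by rewrite frobeniusN.
Qed.

(** Substituting [X (t + h) = X t + h (D + E h)] with [E h] tending to 0, the quotient differs from
    the limit by [2 <E h, X t> + h |D + E h|^2], which [b h] dominates. *)
Lemma deriv_sqr_frobenius m n (X : R -> 'M[R[i]]_(m, n)) (t : R) D :
  has_derivative X t D ->
  deriv_ge0 (fun s => frobenius (X s) ^+ 2) t (2 * ip D (X t)).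
Proof.
rewrite /has_derivative /deriv_ge0; set F := within _ _ => hX.
have FF : Filter F by exact: within_filter.
pose E h := (h^-1)%:C *: (X (t + h) - X t) - D.
have hid : `|h| @[h --> F] --> (0 : R).
  rewrite -[X in _ --> X](normr0 R).
  by apply: cvg_norm; apply: cvg_within_filter; exact: nbhs_dnbhs.
pose b h := 2 * (frobenius (E h) * frobenius (X t))
  + `|h| * (frobenius D + frobenius (E h)) ^+ 2.
have hb : b h @[h --> F] --> (0 : R).
  have -> : (0 : R) = 2 * (0 * frobenius (X t)) + 0 * (frobenius D + 0) ^+ 2.
    by rewrite !mul0r mulr0 addr0.
  apply: cvgD.
    by apply: cvgM; [exact: cvg_cst|apply: cvgM; [exact: hX|exact: cvg_cst]].
  apply: cvgM => //; apply: cvgM; apply: cvgD; do ?[exact: cvg_cst|exact: hX].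
set L := 2 * _.
have hl : L - b h @[h --> F] --> L.
  rewrite -[X in _ --> X]subr0.
  by apply: cvgB => //; exact: cvg_cst.
have hu : L + b h @[h --> F] --> L.
  rewrite -[X in _ --> X]addr0.
  by apply: cvgD => //; exact: cvg_cst.
apply: (squeeze_cvgr _ hl hu).
have : \forall h \near F, h != 0 by apply: cvg_within; apply: withinT.
apply: filterS => h h0.
have -> : h^-1 * (frobenius (X (t + h)) ^+ 2 - frobenius (X t) ^+ 2) =
    L + (2 * ip (E h) (X t) + h * frobenius (D + E h) ^+ 2).
  have -> : X (t + h) = X t + h%:C *: (D + E h).
    have -> : D + E h = (h^-1)%:C *: (X (t + h) - X t).
      by rewrite addrC; exact: subrK.
    rewrite scalerA -rmorphM mulfV //.
    by rewrite rmorph1 scale1r [RHS]addrC subrK.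
  rewrite /L [RHS]addrA -mulrDr -ipDl; move: (D + E h) => Y.
  rewrite !frobeniusE ipDl !ipDr !ipZl !ipZr (ipC (X t) Y).
  by move: (ip Y Y) (ip Y _) (ip (X t) _) => a e g; field.
rewrite -ler_distl addrAC subrr add0r.
apply: le_trans (ler_normD _ _) (lerD _ _); rewrite normrM.
  by rewrite ger0_norm // ler_wpM2l // ip_le_frobenius.
rewrite ler_wpM2l // ger0_norm ?sqr_ge0 //.
rewrite ler_pXn2r ?nnegrE ?addr_ge0 ?frobenius_ge0 //.
exact: frobeniusD.
Qed.

End MatrixDerivative.

Section LoheModel.
Variables (R : realType) (d N : nat) (kappa : R) (H V : 'M[R[i]]_d).

(** Multiply the equation by [- 'i] and, on the right, by [U j t], whose adjoint is its inverse. *)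
Lemma lohe_velocity (U0 : 'I_N -> 'M[R[i]]_d) (U : 'I_N -> R -> 'M[R[i]]_d)
    (j : 'I_N) (t : R) :
  lohe_solution kappa H V U0 U -> 0 <= t ->
  has_derivative (U j) t ((- 'i%C *: H) *m U j t +
    (kappa / (2 * N%:R))%:C *:
      \sum_(k < N) (V *m U k t - U j t *m ((U k t)^t* *m V^t* ) *m U j t)).
Proof.
move=> [hU _ /(_ j t) hD] t0; have [D hD' hDE] := hD t0.
have hUj : (U j t)^t* *m U j t = 1%:M.
  exact: mulmx1C (unitarymxP (hU j t t0)).
suff <- : D = (- 'i%C *: H) *m U j t + (kappa / (2 * N%:R))%:C *:
  \sum_(k < N) (V *m U k t - U j t *m ((U k t)^t* *m V^t* ) *m U j t) by [].
have i2 : - 'i%C * 'i%C = 1 :> R[i] by rewrite mulNr -expr2 sqr_i opprK.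
move/(congr1 (fun A => (- 'i%C *: A) *m U j t)): hDE.
rewrite scalerA i2 scale1r -mulmxA hUj mulmx1 => ->.
rewrite scalerDr mulmxDl scalerA mulrA i2 mul1r; congr (_ + _).
rewrite -scalemxAl; congr (_ *: _).
rewrite mulmx_suml; apply: eq_bigr => k _.
by rewrite mulmxBl -(mulmxA (V *m _)) hUj mulmx1 mulmxA.
Qed.

(* The Hermitian part of the drift acts on the differences by a skew-Hermitian
   matrix, hence does not contribute to the derivative of their norms. *)
Lemma lohe_contraction (W : 'I_N -> 'M[R[i]]_d) (i j : 'I_N) (m : R) :
  (0 < N)%N -> 0 <= kappa -> H \is hermsymmx -> V *m V^t* = 1%:M ->
  (forall k, W k *m (W k)^t* = 1%:M) ->
  (forall k l, frobenius (W k - W l) <= m) ->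
  let velocity j := (- 'i%C *: H) *m W j + (kappa / (2 * N%:R))%:C *:
    \sum_(k < N) (V *m W k - W j *m ((W k)^t* *m V^t* ) *m W j) in
  2 * ip (velocity i - velocity j) (W i - W j) <=
  - (kappa * (2 - (m + frobenius (V - 1%:M)) ^+ 2)
     * frobenius (W i - W j) ^+ 2).
Proof.
move=> N0 kappa0 /is_hermitianmxP hH hV hW hm /=.
rewrite expr0 scale1r in hH.
set K := _ *: H; set c := _ / _; set D := W i - W j; set w := frobenius (V - _).
have hK : K^t* = - K.
  rewrite /K {2}hH linearZ map_mxZ /= -scaleNr; congr (_ *: _).
  by rewrite rmorphN /= opprK; apply/eqP; rewrite eq_complex /= oppr0 opprK !eqxx.
pose Q k := W i *m ((W k)^t* *m V^t* ) *m W i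
  - W j *m ((W k)^t* *m V^t* ) *m W j.
(* The terms [V *m W k] are common to both velocities and cancel. *)
rewrite (_ : _ - _ = K *m D - c%:C *: \sum_k Q k); last first.
  rewrite opprD addrACA -mulmxBr -scalerBr -sumrB; congr (_ + _).
  rewrite -scalerN -sumrN; congr (_ *: _); apply: eq_bigr => k _.
  by rewrite /Q !opprB [LHS]addrC addrA subrK.
rewrite ipBl ip_mulmxl_skew // ipZl ip_suml sub0r.
have hQ : \sum_(k < N) frobenius D ^+ 2 * (2 - (m + w) ^+ 2) <=
    \sum_(k < N) ip (Q k) D.
  apply: ler_sum => k _; rewrite ip_quadratic_difference //.
  have h1 := ip_alignment D hV (hW i) (hW k) (hm i k).
  have h2 := ip_alignment D hV (hW j) (hW k) (hm j k).
  have -> : 2 - (m + w) ^+ 2 =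
    (1 - (m + w) ^+ 2 / 2) + (1 - (m + w) ^+ 2 / 2) by field.
  by rewrite mulrDr; exact: lerD h1 h2.
rewrite sumr_const card_ord -[_ *+ N]mulr_natl in hQ.
have N0' : (N%:R : R) != 0 by rewrite pnatr_eq0 -lt0n.
have c0 : 0 <= c by rewrite divr_ge0 // mulr_ge0.
(* The 2 from differentiating the square and the [N] equal summands undo the division in [c]. *)
have -> : kappa = 2 * (c * N%:R) by rewrite /c; field.
move: (ler_wpM2l c0 hQ); clear; move: c (N%:R) (\sum_k _) ((m + w) ^+ 2).
by move: (frobenius D ^+ 2) => a e n q b; lra.
Qed.

End LoheModel.

(** * Convergence of the diameter *)

Lemma cvg0_sqr_le (R : realType) (g : R -> R) (M c : R) : 0 < c ->
  (forall t, 0 <= t -> 0 <= g t) ->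
  (forall t, 0 <= t -> g t ^+ 2 <= M / (1 + c * t)) ->
  g t @[t --> +oo] --> (0 : R).
Proof.
move=> c0 g0 hg; apply/cvgr0Pnorm_le => e e0; near=> t.
have t0 : 0 <= t by near: t; apply: nbhs_pinfty_ge; exact: num_real.
have ct : 0 < 1 + c * t by rewrite ltr_pwDl ?mulr_ge0 // ltW.
rewrite ger0_norm ?g0 // -(@ler_pXn2r _ 2) ?nnegrE ?g0 ?(ltW e0) //.
apply: le_trans (hg t t0) _; rewrite ler_pdivrMr // mulrDr mulr1.
(* Beyond this time [M <= c * e ^+ 2 * t], which is at most [e ^+ 2 * (1 + c * t)]. *)
have : M / (c * e ^+ 2) <= t by near: t; apply: nbhs_pinfty_ge; exact: num_real.
rewrite ler_pdivrMr ?mulr_gt0 ?exprn_gt0 // => hM.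
apply: le_trans hM _; rewrite mulrA (mulrC (e ^+ 2)) (mulrC t).
by rewrite lerDr sqr_ge0.
Unshelve. all: by end_near. Qed.

Lemma diameter_ge0 (R : realType) d N (X : 'I_N -> 'M[R[i]]_d) :
  0 <= diameter X.
Proof. exact: bigmax_ge_id. Qed.

Lemma frobenius_le_diameter (R : realType) d N (X : 'I_N -> 'M[R[i]]_d) i j :
  frobenius (X i - X j) <= diameter X.
Proof.
apply: le_trans (le_bigmax 0 _ i).
exact: (le_bigmax 0 (fun j => frobenius (X i - X j)) j).
Qed.

Unset Implicit Arguments.
Set Strict Implicit.

Theorem theorem5p1 (R : realType) (d N : nat) (hd : (1 <= d)%N) (hN : (1 <= N)%N)
    (kappa : R) (hkappa : 0 < kappa)
    (H V : 'M[R[i]]_d) (hH : H \is hermsymmx) (hV : V \is unitarymx)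
    (U0 : 'I_N -> 'M[R[i]]_d) (hU0 : forall j, U0 j \is unitarymx)
    (U : 'I_N -> R -> 'M[R[i]]_d) (hU : lohe_solution kappa H V U0 U)
    (hV1 : frobenius (V - 1%:M) < 2 / 3)
    (hdiam : diameter U0 < Num.sqrt (2 - 3 * frobenius (V - 1%:M))) :
  diameter (fun j => U j t) @[t --> +oo] --> (0 : R).
Proof.
set v := frobenius (V - 1%:M) in hV1 hdiam.
have v0 : 0 <= v := frobenius_ge0 _.
set s := Num.sqrt _ in hdiam.
have s0 : 0 <= s := sqrtr_ge0 _.
(* [hV1] makes the radicand positive. *)
have s2 : s ^+ 2 = 2 - 3 * v by rewrite sqr_sqrtr //; lra.
have d0 := diameter_ge0 U0.
(* The midpoint leaves strict room on both sides: the barrier must start above the initial diameter,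
   and the rate is positive for [m < s]. *)
pose m := (diameter U0 + s) / 2.
have dm : diameter U0 < m by rewrite /m; lra.
have ms : m < s by rewrite /m; lra.
have m0 : 0 <= m by apply: le_trans d0 (ltW dm).
have mv : (m + v) ^+ 2 < 2.
  (* Squared, this reads [0 <= 1 + 6 v + v^2]. It gives [(s + v)^2 = 2 - 3 v + 2 s v + v^2 <= 2]. *)
  have sv : 2 * s <= 3 - v.
    by rewrite -(@ler_pXn2r _ 2) ?nnegrE //; nra.
  have : (m + v) ^+ 2 < (s + v) ^+ 2.
    by rewrite ltr_pXn2r ?nnegrE ?addr_ge0 // ltrD2r.
  by move/lt_le_trans; apply; nra.
pose c := kappa * (2 - (m + v) ^+ 2).
have c0 : 0 < c by rewrite mulr_gt0 ?subr_gt0.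
have [Uunit U_init _] := hU.
(* The maximum need not be differentiable, so the barrier is applied to the family of squared
   distances over all pairs. *)
pose f (p : 'I_N * 'I_N) (t : R) := frobenius (U p.1 t - U p.2 t) ^+ 2.
have f_init p : f p 0 < m ^+ 2.
  rewrite /f ltr_pXn2r ?nnegrE ?frobenius_ge0 // !U_init.
  exact: le_lt_trans (frobenius_le_diameter _ _ _) dm.
have f_ge0 p t : 0 <= t -> 0 <= f p t by move=> _; exact: sqr_ge0.
have f_deriv p t : 0 <= t -> exists2 l, deriv_ge0 (f p) t l &
    (forall q, f q t <= m ^+ 2) -> l <= - (c * f p t).
  move=> t0; eexists.
    apply: deriv_sqr_frobenius; apply: has_derivativeB;
      exact: lohe_velocity hU t0.
  move=> hm.
  apply: (@lohe_contraction R d N kappa H V (U^~ t)) => //.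
  - exact: ltW.
  - exact/unitarymxP.
  - by move=> k; exact/unitarymxP/Uunit.
  - move=> k l; rewrite -(@ler_pXn2r _ 2) ?nnegrE ?frobenius_ge0 //.
    exact: hm (k, l).
have decay := family_decay c0 f_init f_ge0 f_deriv.
apply: (@cvg0_sqr_le _ _ (m ^+ 2) _ c0) => [t _|t t0]; first exact: diameter_ge0.
have b0 : 0 <= m ^+ 2 / (1 + c * t).
  by rewrite divr_ge0 ?sqr_ge0 // addr_ge0 // mulr_ge0 // ltW.
(* Taking the root of the bound frees the maximum from its square, so that it can be bounded term by
   term, default value 0 included. *)
rewrite -[leRHS]sqr_sqrtr // ler_pXn2r ?nnegrE ?sqrtr_ge0 ?diameter_ge0 //.
apply: bigmax_le => [|i _]; first exact: sqrtr_ge0.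
apply: bigmax_le => [|j _]; first exact: sqrtr_ge0.
rewrite -(@ler_pXn2r _ 2) ?nnegrE ?sqrtr_ge0 ?frobenius_ge0 // [leRHS]sqr_sqrtr //.
exact: decay (i, j) t t0.
Qed.
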